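(* Let $K$ be an infinite field, $S=K[x_1,\ldots,x_n]$, and let $J$ be a monomial ideal of $S$ with eliminating simplicial complex ${}_J\triangle$. Then the Stanley–Reisner ideal of the Alexander dual ${}_J\triangle^{\vee}$ of ${}_J\triangle$ satisfies $I_{{}_J\triangle^{\vee}}=\sqrt{J}$. In particular, if $J$ is a squarefree monomial ideal, then $I_{{}_J\triangle^{\vee}}=J$.
   Context: Write $[n]=\{1,\ldots,n\}$. For a monomial $u=x_1^{a_1}\cdots x_n^{a_n}$ and $A\subseteq[n]$, put $u(A)=\prod_{i\in A}x_i^{a_i}$. For a monomial ideal $J$ with minimal set of monomial generators $G_{min}(J)$, put $J(A)=\{u(A)\mid u\in G_{min}(J)\}$. The eliminating simplicial complex of $J$ is ${}_J\triangle=\{A\subseteq[n]\mid \langle J(A)\rangle=S\}$. Simplicial complexes on $[n]$ are families of subsets of $[n]$ closed under taking subsets; they are not required to contain all singletons. The Stanley–Reisner ideal $I_{\triangle}$ of a simplicial complex $\triangle$ on $[n]$ is the ideal of $S$ generated by the squarefree monomials $x_B=\prod_{i\in B}x_i$ with $B\subseteq[n]$, $B\notin\triangle$. The Alexander dual is $\triangle^{\vee}=\{[n]\setminus B\mid B\subseteq[n],\ B\notin\triangle\}$. *)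

(* Defs.v *)
From HB Require Import structures.
From mathcomp Require Import all_boot all_order all_algebra.
From mathcomp Require Export mpoly.

Set Implicit Arguments.
Unset Strict Implicit.
Unset Printing Implicit Defensive.

Import GRing.Theory.
Local Open Scope ring_scope.

Definition infinite (T : eqType) : Prop :=
  forall s : seq T, exists x : T, x \notin s.

(* Ideals are Prop-valued predicates. MathComp's [idealr_closed] does not fit: it
is boolean, and it excludes the unit ideal, which is allowed here. *)

Definition is_ideal (R : comNzRingType) (I : R -> Prop) : Prop :=
  [/\ I 0, forall f g, I f -> I g -> I (f + g) & forall a f, I f -> I (a * f)].

Definition ideal_gen (R : comNzRingType) (G : R -> Prop) : R -> Prop :=
  fun f => forall I : R -> Prop, is_ideal I -> (forall g, G g -> I g) -> I f.

Definition radical (R : comNzRingType) (I : R -> Prop) : R -> Prop :=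
  fun f => exists2 k : nat, (0 < k)%N & I (f ^+ k).

(* A set of monomials is given by the set of its exponent vectors. *)

Section MonomialIdeals.
Context {K : fieldType} {n : nat}.
Implicit Types (J : {mpoly K[n]} -> Prop) (G : 'X_{1..n} -> Prop).

Definition monomials G : {mpoly K[n]} -> Prop :=
  fun f => exists2 m, G m & f = 'X_[m].

Definition generates G J : Prop :=
  forall f, J f <-> ideal_gen (monomials G) f.

Definition monomial_ideal J : Prop := exists G, generates G J.

Definition squarefree_monomial_ideal J : Prop :=
  exists2 G, generates G J & forall m, G m -> forall i : 'I_n, (m i <= 1)%N.

Definition min_generates G J : Prop :=
  generates G J /\
  forall G', (forall m, G' m -> G m) -> generates G' J -> forall m, G m -> G' m.

(* The union is harmless: a monomial ideal has exactly one minimal set of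
   monomial generators. *)
Definition Gmin J : 'X_{1..n} -> Prop :=
  fun m => exists2 G, min_generates G J & G m.

Definition mon_restr (u : 'X_{1..n}) (A : {set 'I_n}) : {mpoly K[n]} :=
  \prod_(i in A) 'X_i ^+ u i.

Definition ideal_restr J (A : {set 'I_n}) : {mpoly K[n]} -> Prop :=
  fun f => exists2 u, Gmin J u & f = mon_restr u A.

End MonomialIdeals.

Record simplicial_complex (n : nat) := SimplicialComplex {
  face :> {set 'I_n} -> Prop;
  face_subset : forall A B : {set 'I_n}, A \subset B -> face B -> face A
}.

Section Complexes.
Variables (K : fieldType) (n : nat).
Implicit Types (J : {mpoly K[n]} -> Prop) (D : simplicial_complex n).

Definition elim_face J (A : {set 'I_n}) : Prop :=
  forall f : {mpoly K[n]}, ideal_gen (ideal_restr J A) f.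

Lemma elim_face_subset J (A B : {set 'I_n}) :
  A \subset B -> elim_face J B -> elim_face J A.
Proof.
move=> sAB JB f I idI IA; apply: (JB f I idI) => _ [u Gu ->].
have [_ _ IM] := idI.
rewrite /mon_restr (big_setID A) /= (setIidPr sAB) mulrC.
by apply/IM/IA; exists u.
Qed.

Definition elim_complex J : simplicial_complex n :=
  SimplicialComplex (@elim_face_subset J).

Definition dual_face D (C : {set 'I_n}) : Prop :=
  exists2 B : {set 'I_n}, ~ D B & C = ~: B.

Lemma dual_face_subset D (A B : {set 'I_n}) :
  A \subset B -> dual_face D B -> dual_face D A.
Proof.
move=> sAB [C nDC eB]; exists (~: A); last by rewrite setCK.
move=> DA; apply: nDC; apply: face_subset DA.
by rewrite -[C]setCK -eB setCS.
Qed.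

Definition alexander_dual D : simplicial_complex n :=
  SimplicialComplex (@dual_face_subset D).

Definition stanley_reisner D : {mpoly K[n]} -> Prop :=
  ideal_gen (fun f => exists2 B : {set 'I_n}, ~ D B & f = \prod_(i in B) 'X_i).

End Complexes.

Arguments stanley_reisner K {n} D f.

(* Main.v *)
Require Import Defs.
From HB Require Import structures.
From mathcomp Require Import all_boot all_order all_algebra.
From Stdlib Require Import Classical.

(** Over a field, a polynomial lies in a monomial ideal exactly when each of its
    monomials is divisible by a generator. Hence [A] is a face of the eliminating
    complex iff some minimal generator [u] of [J] is supported off [A], and the
    Stanley-Reisner ideal of the dual is generated by the [x_B] such that [B]
    contains the support of some minimal generator. Each such [x_B] has a power
    in [J], and conversely every minimal generator is a multiple of its squarefree
    part; so the claim follows once ideals generated by squarefree monomials are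
    known to be radical, which is seen on leading monomials. *)

Set Implicit Arguments.
Unset Strict Implicit.
Unset Printing Implicit Defensive.

Import GRing.Theory.
Local Open Scope ring_scope.

Section Ideals.
Variable R : comNzRingType.
Implicit Types (G I : R -> Prop) (f g : R).

Lemma ideal_gen_ideal G : is_ideal (ideal_gen G).
Proof.
split=> [I [] //|f g Gf Gg I idI GI|a f Gf I idI GI]; have [_ ID IM] := idI.
- exact: ID (Gf I idI GI) (Gg I idI GI).
- exact: IM (Gf I idI GI).
Qed.

Lemma mem_ideal_gen G g : G g -> ideal_gen G g.
Proof. by move=> Gg I _; apply. Qed.

Lemma ideal_gen_sub G I : is_ideal I -> (forall g, G g -> I g) ->
  forall f, ideal_gen G f -> I f.
Proof. by move=> idI GI f Gf; exact: (Gf I idI GI). Qed.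

Lemma ideal_sum I (T : eqType) (r : seq T) (F : T -> R) :
  is_ideal I -> (forall i, i \in r -> I (F i)) -> I (\sum_(i <- r) F i).
Proof.
move=> [I0 ID _] IF; rewrite big_seq; by elim/big_ind: _.
Qed.

Lemma ideal_eq I I' : (forall f, I f <-> I' f) -> is_ideal I' -> is_ideal I.
Proof.
move=> E [I0 ID IM]; split=> [|f g /E If /E Ig|a f /E If]; apply/E=> //.
- exact: ID.
- exact: IM.
Qed.

(** For sums, every term of the binomial expansion of [(f + g) ^+ (k + l)] has exponent at least [k]
    on [f] or at least [l] on [g]. *)
Lemma radical_ideal I : is_ideal I -> is_ideal (radical I).
Proof.
move=> idI; have [I0 ID IM] := idI; split.
- by exists 1%N.
- move=> f g [k k0 fk] [l l0 gl]; exists (k + l)%N; first by rewrite addn_gt0 k0.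
  rewrite exprDn; apply: ideal_sum => // i _; rewrite -mulr_natl; apply: (IM).
  have [lt_il|le_li] := ltnP i l.
    have le_k: (k <= k + l - i)%N by rewrite -addnBA ?leq_addr // ltnW.
    by rewrite -(subnK le_k) exprD mulrAC; apply: IM.
  by rewrite -(subnK le_li) exprD mulrA; apply: IM.
- by move=> a f [k k0 fk]; exists k; rewrite // exprMn; apply: IM.
Qed.

End Ideals.

Section Monomials.
Variables (K : fieldType) (n : nat).
Implicit Types (J I : {mpoly K[n]} -> Prop) (G : 'X_{1..n} -> Prop).
Implicit Types (f : {mpoly K[n]}) (m u : 'X_{1..n}) (A B : {set 'I_n}).

Definition mrestr u A : 'X_{1..n} := [multinom if i \in A then u i else 0%N | i < n].

Lemma mon_restrE u A : mon_restr u A = 'X_[mrestr u A] :> {mpoly K[n]}.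
Proof.
rewrite mpolyXE_id /mon_restr big_mkcond; apply: eq_bigr => i _.
by rewrite mnmE; case: ifP; rewrite ?expr0.
Qed.

Lemma ideal_mnm_le I u m : is_ideal I -> (u <= m)%MM -> I 'X_[u] -> I 'X_[m].
Proof. by move=> [_ _ IM] /submK <- Iu; rewrite mpolyXD; apply: IM. Qed.

Lemma mem_monomials G u : G u -> ideal_gen (monomials G) ('X_[u] : {mpoly K[n]}).
Proof. by move=> Gu; apply: mem_ideal_gen; exists u. Qed.

(** The condition on supports defines an ideal, because exponents in a product are sums of exponents
    of the factors; conversely it makes every term of [f] a multiple of a generator. *)
Lemma ideal_monomialsP G f :
  ideal_gen (monomials G) f <->
  forall m, m \in msupp f -> exists2 u, G u & (u <= m)%MM.
Proof.
have idG := ideal_gen_ideal (@monomials K n G).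
split=> [|Gf].
  apply: (ideal_gen_sub (I := fun f => forall m, m \in msupp f ->
    exists2 u, G u & (u <= m)%MM)); last first.
    move=> _ [u Gu ->] m; rewrite msuppX inE => /eqP->.
    by exists u => //; apply: lepm_refl.
  split=> [m|g h Gg Gh m /msuppD_le|a g Gg m /msuppM_le/allpairsP[[m1 m2] /=]].
  - by rewrite msupp0.
  - by rewrite mem_cat => /orP[/Gg|/Gh].
  - case=> _ /Gg[u Gu le_u] ->; exists u => //.
    exact: lepm_trans le_u (lem_addl _ _).
rewrite [f]mpolyE; apply: (ideal_sum idG) => m /Gf[u Gu le_um].
have [_ _ IM] := idG; rewrite -mul_mpolyC; apply: (IM).
by apply: (ideal_mnm_le idG le_um); exact: mem_monomials.
Qed.

(** Induction on the leading monomial: that of [f ^+ k] is the [k]-th power of that of [f], so the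
    leading term of [f] lies in the ideal and can be subtracted. *)
Lemma squarefree_radical G f : (forall m, G m -> forall i, (m i <= 1)%N) ->
  radical (ideal_gen (monomials G)) f -> ideal_gen (monomials G) f.
Proof.
move=> sqG [k k_gt0]; have idG := ideal_gen_ideal (@monomials K n G).
have [I0 ID IM] := idG.
elim/mleadrect: f => f IH Gfk; have [->//|nz_f] := eqVneq f 0.
have GX: ideal_gen (monomials G) 'X_[K, mlead f].
  have nz_fk: f ^+ k != 0 by rewrite expf_neq0.
  have /ideal_monomialsP/(_ _ (mlead_supp nz_fk))[u Gu] := Gfk.
  rewrite mleadX // => /mnm_lepP le_u.
  apply/ideal_monomialsP=> m; rewrite msuppX inE => /eqP->; exists u => //.
  (* When [u i] is 1, the product of [mlead f i] and [k] is positive, hence so is [mlead f i]. *)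
  apply/mnm_lepP=> i; have := le_u i; rewrite mulmnE; have := sqG u Gu i.
  by case: (u i) => [|[]] // _; rewrite muln_gt0 => /andP[].
set q := f - f@_(mlead f) *: 'X_[mlead f].
have Gc: ideal_gen (monomials G) (f@_(mlead f) *: 'X_[mlead f]).
  by rewrite -mul_mpolyC; apply: IM.
suff Gq : ideal_gen (monomials G) q.
  by rewrite -[f](subrK (f@_(mlead f) *: 'X_[mlead f])); exact: ID Gq Gc.
have [->//|nz_q] := eqVneq q 0.
apply: IH; first exact: ltm_mleadD.
(* The difference [q ^+ k - f ^+ k] is a multiple of [q - f], the negated leading term of [f]. *)
rewrite -[_ ^+ k](subrK (f ^+ k)); apply: (ID) => //.
rewrite subrXX mulrC; apply: (IM).
by rewrite addrAC subrr add0r -scaleNr -mul_mpolyC; apply: IM.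
Qed.

Lemma mem_Gmin J u : Gmin J u -> J 'X_[u].
Proof. by case=> G [GJ _] Gu; apply/GJ; exact: mem_monomials. Qed.

(** Ensures that [Gmin J] is large enough to generate [J]: the divisibility-minimal elements of any
    generating set of monomials form a minimal generating set. *)
Lemma Gmin_le J f m : monomial_ideal J -> J f -> m \in msupp f ->
  exists2 u, Gmin J u & (u <= m)%MM.
Proof.
move=> [G GJ] Jf m_f.
pose M u := G u /\ forall v, G v -> (v <= u)%MM -> v = u.
have M_le v : G v -> exists2 u, M u & (u <= v)%MM.
  (* Descent on the degree, which drops strictly when passing to a proper divisor. *)
  have [d] := ubnP (mdeg v); elim: d v => // d IH v le_vd Gv.
  have [Mv|nMv] := classic (M v); first by exists v => //; apply: lepm_refl.
  have [w Gw [le_wv neq_wv]] : exists2 w, G w & (w <= v)%MM /\ w <> v.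
    apply: NNPP => nw; apply: nMv; split=> // w Gw le_wv.
    by apply: NNPP => neq; apply: nw; exists w.
  have lt_wv : (mdeg w < mdeg v)%N.
    rewrite -(submK le_wv) mdegD -[X in (X < _)%N]add0n ltn_add2r lt0n mdeg_eq0.
    by apply: contra_notN neq_wv => /eqP e; rewrite -(submK le_wv) e add0m.
  have [u Mu le_uw] := IH w (leq_trans lt_wv le_vd) Gw.
  by exists u => //; apply: lepm_trans le_wv.
have JM: generates M J.
  move=> g; split=> [/GJ/ideal_monomialsP Gg|/ideal_monomialsP Mg].
    apply/ideal_monomialsP=> p /Gg[v /M_le[u Mu le_uv] le_vp].
    by exists u => //; apply: lepm_trans le_vp.
  by apply/GJ/ideal_monomialsP=> p /Mg[u [Gu _] le_up]; exists u.
have minM: min_generates M J.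
  split=> // G' sG'M G'J u Mu.
  (* Some [v] in [G'] divides [u], and minimality of [u] in [G] forces [v = u]. *)
  have /G'J/ideal_monomialsP/(_ u): J 'X_[u] by apply/JM; exact: mem_monomials.
  rewrite msuppX mem_head => /(_ isT)[v G'v le_vu].
  by have [_ /(_ v (proj1 (sG'M v G'v)) le_vu) <-] := Mu.
have /JM/ideal_monomialsP/(_ m m_f)[u Mu le_um] := Jf.
by exists u => //; exists M.
Qed.

(** The ideal is the whole ring iff it contains 1, and a monomial ideal contains 1 only if one of
    its generators [mon_restr u A] is itself 1. *)
Lemma elim_faceP J A :
  elim_face J A <-> exists2 u, Gmin J u & forall i, i \in A -> u i = 0%N.
Proof.
split=> [/(_ 1) J1|[u Ju uA0] f].
  have /ideal_monomialsP/(_ 0%MM): ideal_gen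
      (monomials (fun m => exists2 u, Gmin J u & m = mrestr u A)) (1 : {mpoly K[n]}).
    apply: (ideal_gen_sub (ideal_gen_ideal _)) J1 => _ [u Ju ->].
    by rewrite mon_restrE; apply: mem_monomials; exists u.
  rewrite msupp1 mem_head => /(_ isT)[_ [u Ju ->] /mnm_lepP le0].
  by exists u => // i iA; have := le0 i; rewrite mnmE iA mnm0E leqn0 => /eqP.
rewrite -[f]mulr1; have [_ _ IM] := ideal_gen_ideal (ideal_restr J A).
apply: (IM); apply: mem_ideal_gen; exists u => //.
by rewrite /mon_restr big1 // => i /uA0->; rewrite expr0.
Qed.

(** Nonfaces of the dual are the complements of faces of [elim_complex J], so [elim_faceP] applies
    to [~: B]. *)
Lemma not_dual_faceP J B :
  ~ alexander_dual (elim_complex J) B <->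
  exists2 u, Gmin J u & forall i, i \notin B -> u i = 0%N.
Proof.
split=> [nDB|[u Ju u0] [C /= nJC eB]].
  have /elim_faceP[u Ju u0]: elim_face J (~: B).
    by apply: NNPP => nJB; apply: nDB; exists (~: B); rewrite ?setCK.
  by exists u => // i iB; rewrite u0 // inE.
by apply/nJC/elim_faceP; exists u => // i iC; rewrite u0 // eB inE negbK.
Qed.

Definition mset B : 'X_{1..n} := [multinom (i \in B : nat) | i < n].

Lemma prod_varsE B : \prod_(i in B) 'X_i = 'X_[mset B] :> {mpoly K[n]}.
Proof.
rewrite mpolyXE_id big_mkcond; apply: eq_bigr => i _.
by rewrite mnmE; case: ifP; rewrite ?expr0.
Qed.

Lemma stanley_reisnerE (D : simplicial_complex n) f :
  stanley_reisner K D f <->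
  ideal_gen (monomials (fun m => exists2 B, ~ D B & m = mset B)) f.
Proof.
split; apply: (ideal_gen_sub (ideal_gen_ideal _)).
  by move=> _ [B DB ->]; rewrite prod_varsE; apply: mem_monomials; exists B.
by move=> _ [_ [B DB ->] ->]; apply: mem_ideal_gen; exists B; rewrite ?prod_varsE.
Qed.

Lemma stanley_reisner_radical (D : simplicial_complex n) f :
  radical (stanley_reisner K D) f -> stanley_reisner K D f.
Proof.
move=> [k k_gt0 /stanley_reisnerE fk]; apply/stanley_reisnerE.
apply: squarefree_radical; last by exists k.
by move=> _ [B _ ->] i; rewrite mnmE leq_b1.
Qed.

Lemma monomial_ideal_ideal J : monomial_ideal J -> is_ideal J.
Proof. by case=> G GJ; apply: ideal_eq GJ (ideal_gen_ideal _). Qed.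

Lemma sub_stanley_reisner J f : monomial_ideal J -> J f ->
  stanley_reisner K (alexander_dual (elim_complex J)) f.
Proof.
move=> monJ Jf; apply/stanley_reisnerE/ideal_monomialsP=> m m_f.
have [u Ju /mnm_lepP le_um] := Gmin_le monJ Jf m_f.
(* The squarefree part of [u] divides [u], hence also [m]. *)
exists (mset [set i | u i != 0%N]).
  exists [set i | u i != 0%N] => //; apply/not_dual_faceP.
  by exists u => // i; rewrite inE negbK => /eqP.
apply/mnm_lepP=> i; apply: leq_trans (le_um i).
by rewrite mnmE inE; case: (u i).
Qed.

Lemma stanley_reisner_sub_radical J f : monomial_ideal J ->
  stanley_reisner K (alexander_dual (elim_complex J)) f -> radical J f.
Proof.
move=> /monomial_ideal_ideal idJ.
apply: (ideal_gen_sub (radical_ideal idJ)) => _ [B /not_dual_faceP[u Ju u0] ->].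
(* Each exponent of [u] is at most [mdeg u]; the successor keeps the power positive when [u] is
   0. *)
exists (mdeg u).+1; rewrite // prod_varsE mpolyXn.
apply: ideal_mnm_le idJ _ (mem_Gmin Ju); apply/mnm_lepP=> i.
rewrite mulmnE mnmE; have [iB|/u0->//] := boolP (i \in B).
by rewrite mul1n ltnW // ltnS mdegE (bigD1 i) //= leq_addr.
Qed.

End Monomials.

Theorem proposition4p4 (K : fieldType) (Kinf : infinite K) (n : nat)
    (J : {mpoly K[n]} -> Prop) (Jmon : monomial_ideal J) :
  (forall f : {mpoly K[n]},
     stanley_reisner K (alexander_dual (elim_complex J)) f
     <-> radical J f)
  /\ (squarefree_monomial_ideal J ->
      forall f : {mpoly K[n]},
        stanley_reisner K (alexander_dual (elim_complex J)) f <-> J f).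
Proof.
have SRE f : stanley_reisner K (alexander_dual (elim_complex J)) f <-> radical J f.
  split=> [|[k k_gt0 Jfk]]; first exact: stanley_reisner_sub_radical.
  (* From [f ^+ k] in [J], the power lies in the Stanley-Reisner ideal, which is radical. *)
  apply: stanley_reisner_radical; exists k => //.
  exact: sub_stanley_reisner.
split=> // -[G GJ sqG] f.
split=> [/SRE[k k_gt0 Jfk]|]; last exact: sub_stanley_reisner.
by apply/GJ; apply: squarefree_radical => //; exists k; last exact/GJ.
Qed.
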